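(* Let $\alpha: I\subset\mathbb{R}\to\mathbb{R}^3_1$ be a null curve with Frenet frame $\{V_1,V_2,V_3\}$ and nowhere zero curvatures $\kappa,\tau$. Let $f:\mathbb{R}^3_1\to\mathbb{R}$ be a smooth function which is eikonal along $\alpha$ and whose Hessian satisfies $H^f=0$. If $\alpha$ is a null $f$-eikonal $V_2$-slant helix curve in $\mathbb{R}^3_1$, then $\alpha$ is also a null $f$-eikonal helix curve in $\mathbb{R}^3_1$, with axis $$\nabla f=c\left(\frac{-\tau}{\kappa}V_1+V_2\right)$$ along $\alpha$, where $g(\nabla f,V_1)=c$ is a non-zero constant.
   Context: $\mathbb{R}^3_1$ is $\mathbb{R}^3$ with the Lorentzian metric $g(a,b)=-a_1b_1+a_2b_2+a_3b_3$, and $\nabla$ is its Levi-Civita connection. A curve $\alpha(s)$ is null if $g(\alpha',\alpha')=0$. A Cartan (Frenet) frame of a null curve $\alpha$ is a family of vector fields $V_1,V_2,V_3$ along $\alpha$ with $V_1=\alpha'$, $g(V_1,V_1)=g(V_2,V_2)=0$, $g(V_1,V_2)=1$, $g(V_1,V_3)=g(V_2,V_3)=0$, $g(V_3,V_3)=1$, satisfying $$\nabla_{V_1}V_1=\kappa V_3,\quad \nabla_{V_1}V_2=\tau V_3,\quad \nabla_{V_1}V_3=-\tau V_1-\kappa V_2,$$ where $\kappa$ and $\tau$ are called the curvature and torsion. For $f$ smooth, $\nabla f$ is the gradient with respect to $g$, $g(\nabla f,X)=X(f)$, and the Hessian is $H^f(X,Y)=g(\nabla_X(\nabla f),Y)$.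 The function $f$ is eikonal along $\alpha$ if $\|\nabla f\|=\sqrt{|g(\nabla f,\nabla f)|}$ is constant along $\alpha$. Suppose $f$ is eikonal along the null curve $\alpha$. Then $\alpha$ is a null $f$-eikonal helix curve if $g(\nabla f,V_1)$ is a non-zero constant along $\alpha$, and a null $f$-eikonal $V_2$-slant helix curve if $g(\nabla f,V_2)$ is a non-zero constant along $\alpha$; in either case $\nabla f$ is called its axis. *)

(* Defs.v *)
From HB Require Import structures.
From mathcomp Require Import all_boot all_order all_algebra.
From mathcomp Require Import all_classical all_reals all_analysis.

Set Implicit Arguments.
Unset Strict Implicit.
Unset Printing Implicit Defensive.

Import Order.TTheory GRing.Theory Num.Theory.
Import numFieldNormedType.Exports.

Local Open Scope classical_set_scope.
Local Open Scope ring_scope.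

(* Points and tangent vectors of Minkowski 3-space are both rows
   (a_1, a_2, a_3); the coordinates are indexed here by 0, 1, 2. *)
Definition lorentz (R : realType) (a b : 'rV[R]_3) : R :=
  - (a 0 0 * b 0 0) + a 0 1 * b 0 1 + a 0 2%:R * b 0 2%:R.

(* C^oo on the whole space: every iterated directional derivative exists and is
   (Frechet) differentiable everywhere, hence continuous. *)
Definition smooth_fun (R : realType) (f : 'rV[R]_3 -> R) : Prop :=
  forall (vs : seq 'rV[R]_3) (p : 'rV[R]_3),
    differentiable (foldr (fun v h => 'D_v h) f vs) p.

(* C^oo on I, where I is meant to be open: values outside I are irrelevant. *)
Definition smooth_along (R : realType) (I : set R) (x : R -> 'rV[R]_3) : Prop :=
  forall (n : nat) (s : R), I s -> derivable (derive1n n x) s 1.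

(* The Levi-Civita connection: lorentz has constant coefficients, so the
   Christoffel symbols vanish in the standard coordinates and nabla_u Z is the
   directional derivative of Z. *)
Definition nabla (R : realType) (u : 'rV[R]_3) (Z : 'rV[R]_3 -> 'rV[R]_3)
    (p : 'rV[R]_3) : 'rV[R]_3 :=
  'D_u Z p.

(* The induced derivative nabla_{alpha'} Z of a field Z along a curve alpha;
   the vanishing of the Christoffel symbols makes it independent of alpha. *)
Definition nabla_along (R : realType) (Z : R -> 'rV[R]_3) (s : R) : 'rV[R]_3 :=
  derive1 Z s.

(* Raising the index of df changes the sign of the first coordinate. *)
Definition grad (R : realType) (f : 'rV[R]_3 -> R) (p : 'rV[R]_3) : 'rV[R]_3 :=
  \row_(i < 3) ((if i == 0 then -1 else 1) * 'D_(delta_mx 0 i) f p).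

Definition hessian (R : realType) (f : 'rV[R]_3 -> R) (p u v : 'rV[R]_3) : R :=
  lorentz (nabla u (grad f) p) v.

Lemma gradP (R : realType) (f : 'rV[R]_3 -> R) (p u : 'rV[R]_3) :
  differentiable f p -> lorentz (grad f p) u = 'D_u f p.
Proof.
move=> df; rewrite [in RHS](row_sum_delta u) deriveE// linear_sum/=.
rewrite 3!big_ord_recl big_ord0 addr0 /lorentz !mxE /= !deriveE// !linearZ/=.
have -> : lift ord0 ord0 = 1 :> 'I_3 by apply/val_inj.
have -> : lift ord0 (lift ord0 ord0) = 2%:R :> 'I_3 by apply/val_inj.
by rewrite /GRing.scale/= mulN1r mulrNN !mul1r addrA ![u _ _ * _]mulrC.
Qed.

Lemma lorentz_nondeg (R : realType) (a b : 'rV[R]_3) :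
  (forall u, lorentz a u = lorentz b u) -> a = b.
Proof.
move=> ab; have := (ab (delta_mx 0 0), ab (delta_mx 0 1), ab (delta_mx 0 2%:R)).
rewrite /lorentz !mxE /= !(mulr0, mulr1, addr0, add0r, oppr0).
move=> [[/oppr_inj a0 a1] a2]; apply/rowP => -[[|[|[|//]]] i3].
- by have -> : Ordinal i3 = 0 by apply/val_inj.
- by have -> : Ordinal i3 = 1 by apply/val_inj.
- by have -> : Ordinal i3 = 2%:R by apply/val_inj.
Qed.

Definition null_curve (R : realType) (I : set R) (alpha : R -> 'rV[R]_3) : Prop :=
  smooth_along I alpha /\
  forall s, I s -> lorentz (derive1 alpha s) (derive1 alpha s) = 0.

Record cartan_frame (R : realType) (I : set R) (alpha : R -> 'rV[R]_3)
    (V1 V2 V3 : R -> 'rV[R]_3) (kappa tau : R -> R) : Prop := CartanFrame {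
  frame_smooth1 : smooth_along I V1;
  frame_smooth2 : smooth_along I V2;
  frame_smooth3 : smooth_along I V3;
  frame_tangent : forall s, I s -> V1 s = derive1 alpha s;
  frame_g11 : forall s, I s -> lorentz (V1 s) (V1 s) = 0;
  frame_g22 : forall s, I s -> lorentz (V2 s) (V2 s) = 0;
  frame_g12 : forall s, I s -> lorentz (V1 s) (V2 s) = 1;
  frame_g13 : forall s, I s -> lorentz (V1 s) (V3 s) = 0;
  frame_g23 : forall s, I s -> lorentz (V2 s) (V3 s) = 0;
  frame_g33 : forall s, I s -> lorentz (V3 s) (V3 s) = 1;
  frame_nabla1 : forall s, I s -> nabla_along V1 s = kappa s *: V3 s;
  frame_nabla2 : forall s, I s -> nabla_along V2 s = tau s *: V3 s;
  frame_nabla3 : forall s, I s ->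
    nabla_along V3 s = - tau s *: V1 s - kappa s *: V2 s }.

Definition eikonal_along (R : realType) (I : set R) (alpha : R -> 'rV[R]_3)
    (f : 'rV[R]_3 -> R) : Prop :=
  exists k : R, forall s, I s ->
    Num.sqrt `|lorentz (grad f (alpha s)) (grad f (alpha s))| = k.

Definition nonzero_constant_on (R : realType) (I : set R) (h : R -> R) : Prop :=
  exists c : R, c != 0 /\ forall s, I s -> h s = c.

(* V1 is meant to be the first vector field of a Cartan frame of alpha. *)
Definition null_eikonal_helix (R : realType) (I : set R)
    (alpha V1 : R -> 'rV[R]_3) (f : 'rV[R]_3 -> R) : Prop :=
  [/\ null_curve I alpha, eikonal_along I alpha f &
    nonzero_constant_on I (fun s => lorentz (grad f (alpha s)) (V1 s))].

(* V2 is meant to be the second vector field of a Cartan frame of alpha. *)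
Definition null_eikonal_V2_slant_helix (R : realType) (I : set R)
    (alpha V2 : R -> 'rV[R]_3) (f : 'rV[R]_3 -> R) : Prop :=
  [/\ null_curve I alpha, eikonal_along I alpha f &
    nonzero_constant_on I (fun s => lorentz (grad f (alpha s)) (V2 s))].

(* Main.v *)
Require Import Defs.
From mathcomp Require Import all_boot all_order all_algebra.
From mathcomp Require Import all_classical all_reals all_analysis.
Import Order.TTheory GRing.Theory Num.Theory.
Import numFieldNormedType.Exports.
Local Open Scope classical_set_scope.
Local Open Scope ring_scope.

(** The vanishing of the Hessian makes the gradient a constant vector [W] of
    the flat space ([grad_constant]), so each frame component
    [a_i = lorentz (V_i) W] can be differentiated through the Frenet equations
    alone ([is_derive_lorentz]). Write [a_2 = c_0], a non-zero constant.

    Then [0 = a_2' = tau a_3] gives [a_3 = 0] because [tau] has no zero. Next,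
    [0 = a_3' = - tau a_1 - kappa a_2] gives [tau a_1 = - kappa c_0], so [a_1]
    has no zero, while [a_1' = kappa a_3 = 0] makes [a_1] a constant [c] on the
    interval. The basis dual to [(V_1, V_2, V_3)] for the Lorentzian metric is
    [(V_2, V_1, V_3)], hence [W = a_2 V_1 + a_1 V_2 + a_3 V_3]
    ([cartan_expansion]), and [a_2 = - (tau / kappa) c] turns this into the
    announced axis. *)

Lemma lorentzC (R : realType) (a b : 'rV[R]_3) : lorentz a b = lorentz b a.
Proof. by rewrite /lorentz ![a _ _ * _]mulrC. Qed.

Lemma lorentzZl (R : realType) (k : R) (a b : 'rV[R]_3) :
  lorentz (k *: a) b = k * lorentz a b.
Proof. by rewrite /lorentz !mxE !mulrDr mulrN !mulrA. Qed.

Lemma lorentz_sum (R : realType) (a b : 'rV[R]_3) :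
  lorentz a b =
  \sum_(k < 3) a 0 k * ((if k == 0 then -1 else 1) * b 0 k).
Proof.
rewrite 3!big_ord_recl big_ord0 addr0 /lorentz /= mulN1r mulrN !mul1r addrA.
have -> : lift ord0 ord0 = 1 :> 'I_3 by apply/val_inj.
by have -> : lift ord0 (lift ord0 ord0) = 2%:R :> 'I_3 by apply/val_inj.
Qed.

Lemma lorentzDl (R : realType) (a b c : 'rV[R]_3) :
  lorentz (a + b) c = lorentz a c + lorentz b c.
Proof.
rewrite !lorentz_sum -big_split.
by apply: eq_bigr => k _; rewrite mxE mulrDl.
Qed.

(** Biorthogonality says that the matrix of the [v i] has a right inverse, built
    from the [v' j]; for square matrices it is also a left inverse, and this is
    the expansion formula. *)
Lemma lorentz_dual_basis (R : realType) (v v' : 'I_3 -> 'rV[R]_3) :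
  (forall i j, lorentz (v i) (v' j) = (i == j)%:R) ->
  forall w, w = \sum_(j < 3) lorentz w (v' j) *: v j.
Proof.
move=> dual w.
pose M : 'M[R]_3 := \matrix_(i < 3) v i.
pose N : 'M[R]_3 := \matrix_(k, j) ((if k == 0 then -1 else 1) * v' j 0 k).
have MN : M *m N = 1%:M.
  apply/matrixP => i j; rewrite !mxE -dual lorentz_sum.
  by apply: eq_bigr => k _; rewrite !mxE.
rewrite -[LHS]mulmx1 -(mulmx1C MN) mulmxA mulmx_sum_row.
apply: eq_bigr => j _; rewrite rowK lorentz_sum mxE.
by congr (_ *: _); apply: eq_bigr => k _; rewrite mxE.
Qed.

(** The two null vectors of a Cartan frame are dual to each other, so the
    coefficient on [v1] is the product with [v2], and conversely. *)
Lemma cartan_expansion (R : realType) (v1 v2 v3 : 'rV[R]_3) :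
  lorentz v1 v1 = 0 -> lorentz v2 v2 = 0 -> lorentz v1 v2 = 1 ->
  lorentz v1 v3 = 0 -> lorentz v2 v3 = 0 -> lorentz v3 v3 = 1 ->
  forall w,
  w = lorentz w v2 *: v1 + lorentz w v1 *: v2 + lorentz w v3 *: v3.
Proof.
move=> g11 g22 g12 g13 g23 g33 w.
have := @lorentz_dual_basis R (fun i => nth v3 [:: v1; v2] i)
  (fun i => nth v3 [:: v2; v1] i).
move=> /(_ _ w); rewrite 3!big_ord_recl big_ord0 addr0 addrA; apply.
by move=> [[|[|[|//]]] ?] [[|[|[|//]]] ?]; rewrite /= ?g11 ?g22 ?g12 ?g13 ?g23
  ?g33 // lorentzC ?g11 ?g22 ?g12 ?g13 ?g23 ?g33.
Qed.

Lemma is_derive_lorentz (R : realType) (V : normedModType R)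
    (Z : V -> 'rV[R]_3) (p v : V) (w : 'rV[R]_3) : derivable Z p v ->
  is_derive p v (fun q => lorentz (Z q) w) (lorentz ('D_v Z p) w).
Proof.
move=> dZ; have dZi k : is_derive p v (fun q => Z q 0 k) ('D_v Z p 0 k).
  by rewrite derive_mx // mxE; apply: derivableP; move/derivable_mxP: dZ.
have -> : (fun q => lorentz (Z q) w) =
    \sum_(k < 3) ((if k == 0 then -1 else 1) * w 0 k) \*: (fun q => Z q 0 k).
  apply/funext => q; rewrite lorentz_sum fct_sumE.
  by apply: eq_bigr => k _; rewrite /= mulrC.
rewrite lorentz_sum; apply: is_derive_sum => k; rewrite [_ 0 k * _]mulrC.
exact: is_deriveZ.
Qed.

Lemma is_derive_line (R : realType) (V W : normedModType R)
    (F : V -> W) (q v : V) (t : R) (d : W) :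
  is_derive (t *: v + q) v F d -> is_derive t 1 (fun s => F (s *: v + q)) d.
Proof.
have E : (fun h : R => h^-1 *: (F ((h *: 1 + t) *: v + q) - F (t *: v + q))) =
    (fun h : R => h^-1 *: (F (h *: v + (t *: v + q)) - F (t *: v + q))).
  by apply/funext => h; rewrite [h *: 1]mulr1 scalerDl addrA.
by move=> [cF <-]; apply: DeriveDef; rewrite /derivable /derive /= E.
Qed.

Lemma interval_derive0_constant (R : realType) (I : set R) (h : R -> R) :
  is_interval I -> (forall s, I s -> is_derive s 1 h 0) ->
  forall a b, I a -> I b -> h a = h b.
Proof.
move=> itv dh a b.
wlog ab : a b / a <= b.
  by move=> H Ia Ib; case: (leP a b) => [|/ltW] /H ->.
move=> Ia Ib.
have Iab x : x \in `[a, b]%R -> I x.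
  by rewrite in_itv /= => xab; exact: itv Ia Ib x xab.
have [||c _ hab] := @MVT_segment R h (fun=> 0) a b ab.
- by move=> x xab; apply/dh/Iab; exact: subset_itv_oo_cc.
- by apply: derivable_within_continuous => x /Iab /dh [].
- by apply/esym/subr0_eq; rewrite hab mul0r.
Qed.

Lemma derivable_grad (R : realType) (f : 'rV[R]_3 -> R) (p v : 'rV[R]_3) :
  smooth_fun f -> derivable (grad f) p v.
Proof.
move=> sf; apply/derivable_mxP => i j.
have -> : (fun x => grad f x i j) =
    (if j == 0 then -1 else 1) \*: 'D_(delta_mx 0 j) f.
  by apply/funext => x; rewrite mxE.
by apply/derivableZ/diff_derivable; exact: (sf [:: delta_mx 0 j]).
Qed.

(** Along a line, the derivative of a component of the gradient is a value of
    the Hessian. *)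
Lemma grad_constant (R : realType) (f : 'rV[R]_3 -> R) :
  smooth_fun f -> (forall p u v, hessian f p u v = 0) ->
  forall p q, grad f p = grad f q.
Proof.
move=> sf H0 p q; apply: lorentz_nondeg => u.
pose g (t : R) := lorentz (grad f (t *: (p - q) + q)) u.
have -> : lorentz (grad f p) u = g 1 by rewrite /g scale1r subrK.
have -> : lorentz (grad f q) u = g 0 by rewrite /g scale0r add0r.
apply: is_derive_0_is_cst => t.
apply: (@is_derive_line R _ _ (fun x => lorentz (grad f x) u)).
rewrite -(H0 (t *: (p - q) + q) (p - q) u).
exact/is_derive_lorentz/derivable_grad.
Qed.

Theorem theorem3p2 (R : realType) (I : set R)
    (alpha V1 V2 V3 : R -> 'rV[R]_3) (kappa tau : R -> R) (f : 'rV[R]_3 -> R)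
    (I_open : open I) (I_itv : is_interval I)
    (alpha_null : null_curve I alpha)
    (frame : cartan_frame I alpha V1 V2 V3 kappa tau)
    (kappa_neq0 : forall s, I s -> kappa s != 0)
    (tau_neq0 : forall s, I s -> tau s != 0)
    (f_smooth : smooth_fun f)
    (f_eikonal : eikonal_along I alpha f)
    (f_hessian : forall p u v, hessian f p u v = 0) :
  null_eikonal_V2_slant_helix I alpha V2 f ->
  null_eikonal_helix I alpha V1 f /\
  exists c : R, c != 0 /\
    forall s, I s ->
      lorentz (grad f (alpha s)) (V1 s) = c /\
      grad f (alpha s) = c *: ((- tau s / kappa s) *: V1 s + V2 s).
Proof.
case=> _ _ [c0 [c0_neq0 slant]].
case: frame => sV1 sV2 sV3 _ g11 g22 g12 g13 g23 g33 n1 n2 n3.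
suff [c [c_neq0 axis]] : exists c : R, c != 0 /\ forall s, I s ->
    lorentz (grad f (alpha s)) (V1 s) = c /\
    grad f (alpha s) = c *: ((- tau s / kappa s) *: V1 s + V2 s).
  split; last by exists c.
  by split=> //; exists c; split=> // s /axis[].
pose W := grad f 0.
have gradW s : grad f (alpha s) = W by exact: grad_constant.
have derive_comp (V : R -> 'rV[R]_3) (s : R) : smooth_along I V -> I s ->
    is_derive s 1 (fun t => lorentz (V t) W) (lorentz (nabla_along V s) W).
  by move=> sV Is; rewrite /nabla_along derive1E;
    apply: is_derive_lorentz; exact: (sV 0%N).
(* Openness of I is what allows differentiating an identity valid on I only. *)
have derive_comp_cst (V : R -> 'rV[R]_3) (k s : R) : smooth_along I V -> I s ->
    (forall t, I t -> lorentz (V t) W = k) -> lorentz (nabla_along V s) W = 0.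
  move=> sV Is Vk; have [_ <-] := derive_comp V s sV Is.
  rewrite (@near_eq_derive _ _ _ _ (cst k)) ?derive_cst //.
  by near do apply: Vk; exact: open_nbhs_nbhs.
have a2 s : I s -> lorentz (V2 s) W = c0.
  by move=> Is; rewrite lorentzC -(gradW s) slant.
have a3 s : I s -> lorentz (V3 s) W = 0.
  move=> Is; have /eqP := derive_comp_cst V2 c0 s sV2 Is a2.
  by rewrite n2 // lorentzZl mulf_eq0 (negPf (tau_neq0 s Is)) => /eqP.
have a1 s : I s -> tau s * lorentz (V1 s) W = - (kappa s * c0).
  move=> Is; have /eqP := derive_comp_cst V3 0 s sV3 Is a3.
  rewrite n3 // -scaleNr lorentzDl !lorentzZl a2 // mulNr mulNr subr_eq0.
  by move=> /eqP <-; rewrite opprK.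
have a1_cst s t : I s -> I t -> lorentz (V1 s) W = lorentz (V1 t) W.
  pose a := fun r => lorentz (V1 r) W.
  apply: (@interval_derive0_constant R I a) => // r Ir.
  have := derive_comp V1 r sV1 Ir.
  by rewrite n1 // lorentzZl a3 // mulr0.
(* The constant exists even when I is empty; any non-zero value then works. *)
have [[s0 Is0]|I0] := pselect (exists s, I s); last first.
  by exists 1; split=> [|s Is]; [exact: oner_neq0|case: I0; exists s].
exists (lorentz (V1 s0) W); split.
  apply: contraTneq isT => a10; have /esym/eqP := a1 s0 Is0.
  by rewrite a10 mulr0 oppr_eq0 mulf_eq0 (negPf (kappa_neq0 _ Is0)) (negPf c0_neq0).
move=> s Is; rewrite gradW lorentzC (a1_cst s0 s) //; split=> //.
rewrite [LHS](cartan_expansion _ _ _ _ (g11 s Is) (g22 s Is) (g12 s Is)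
  (g13 s Is) (g23 s Is) (g33 s Is)).
rewrite ![lorentz W _]lorentzC a3 // a2 // scale0r addr0 scalerDr scalerA.
congr (_ *: _ + _).
apply: (mulIf (kappa_neq0 s Is)).
by rewrite -mulrA divfK ?kappa_neq0 // mulrN [_ * tau s]mulrC a1 // opprK mulrC.
Unshelve. all: by end_near.
Qed.
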